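(* Let $D=D_1\times\dots\times D_n$ be a generic product distribution over profiles of XOS valuations on the item set $[m]$, let $\alpha\in[0,1/2]$, and let $\mathbf{p}\in\mathbb{R}_{\ge0}^m$ be $\alpha$-median prices for $D$. Then the expected social welfare of the sequential posted-price mechanism using prices $\mathbf{p}$ is at least $\alpha$ times the expected optimal social welfare, i.e. $$\mathbb{E}_{\mathbf{v}\sim D}\Big[\sum_{i=1}^n v_i(X_i(\mathbf{v},\mathbf{p}))\Big]\ \ge\ \alpha\cdot\mathbb{E}_{\mathbf{v}\sim D}\Big[\max_{(A_1,\dots,A_n)}\sum_{i=1}^n v_i(A_i)\Big],$$ where $X_i(\mathbf{v},\mathbf{p})$ is the set bought by buyer $i$ and the maximum is over all tuples of pairwise disjoint sets $A_1,\dots,A_n\subseteq[m]$.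
   Context: Valuations are functions $v:2^{[m]}\to\mathbb{R}_{\ge0}$ with $v(\emptyset)=0$ that are monotone ($v(S)\le v(T)$ for $S\subseteq T$). $v$ is XOS if there is a finite collection of additive functions $a_\ell(B)=\sum_{j\in B}a_\ell(j)$ with $a_\ell(j)\ge0$ such that $v(B)=\max_\ell a_\ell(B)$ for all $B\subseteq[m]$. Demand: for $\mathbf{p}\in\mathbb{R}_{\ge0}^m$ and $M\subseteq[m]$, $\mathcal{D}(v,\mathbf{p},M)$ is the set of all $B\subseteq M$ maximizing $v(B)-\sum_{j\in B}p_j$ over subsets of $M$. Generic: a distribution $D_i$ over valuations is generic if for every $\mathbf{p}\in\mathbb{R}_{\ge0}^m$ and $M\subseteq[m]$, $\mathcal{D}(v_i,\mathbf{p},M)$ contains only one set with probability one over $v_i\sim D_i$. A distribution over profiles is generic if each agent's marginal is generic. Sequential posted-price mechanism with prices $\mathbf{p}$: buyers $1,\dots,n$ arrive in this order; buyer $i$ buys a set $X_i(\mathbf{v},\mathbf{p})\in\mathcal{D}(v_i,\mathbf{p},M_i)$, where $M_i=[m]\setminus(X_1\cup\dots\cup X_{i-1})$ (almost surely unique for generic $D$). Let $\pi_j(\mathbf{p})$ be the probability over $\mathbf{v}\sim D$ that item $j$ is sold. $\alpha$-median prices for generic $D$: $\pi_j(\mathbf{p})\le1-\alpha$ for every $j\in[m]$, and $\pi_j(\mathbf{p})\ge\alpha$ for every $j$ with $p_j>0$. *)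

(* Defs.v *)
From HB Require Import structures.
From mathcomp Require Import all_boot all_order all_algebra.
From mathcomp Require Import all_classical all_reals all_analysis.

Set Implicit Arguments.
Unset Strict Implicit.
Unset Printing Implicit Defensive.

Import Order.TTheory GRing.Theory Num.Theory.
Import numFieldNormedType.Exports.
Local Open Scope classical_set_scope.
Local Open Scope ring_scope.

(* The items are 'I_m, the buyers are 'I_n and arrive in increasing order. *)

(* Arbitrary set functions carry the Borel structure of R^(2^[m]), generated by
   the evaluations v |-> v B.  Being an (XOS) valuation is a separate predicate,
   imposed on distributions almost surely. *)
Definition evaluation_events (m : nat) (R : realType) :
    set (set ({set 'I_m} -> R)) :=
  [set E | exists (B : {set 'I_m}) (U : set R),
     measurable U /\ E = [set v | U (v B)]].

Definition setfun (m : nat) (R : realType) :=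
  g_sigma_algebraType (@evaluation_events m R).

(* Component i of a profile v is [tnth v i]; tuples carry the product
   sigma-algebra. *)
Definition profile (n m : nat) (R : realType) := n.-tuple (setfun m R).

Definition is_valuation (m : nat) (R : realType) (v : {set 'I_m} -> R) : Prop :=
  [/\ v finset.set0 = 0,
      forall S, 0 <= v S &
      forall S T : {set 'I_m}, S \subset T -> v S <= v T].

(* The two clauses on B say that v B is the maximum of the additive functions;
   the second one also makes the collection nonempty. *)
Definition is_XOS (m : nat) (R : realType) (v : {set 'I_m} -> R) : Prop :=
  exists (k : nat) (a : 'I_k -> 'I_m -> R),
    (forall l j, 0 <= a l j) /\
    (forall B : {set 'I_m},
       (forall l, \sum_(j in B) a l j <= v B) /\
       (exists l, v B = \sum_(j in B) a l j)).

Definition utility (m : nat) (R : realType) (v : {set 'I_m} -> R)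
    (p : 'I_m -> R) (B : {set 'I_m}) : R :=
  v B - \sum_(j in B) p j.

Definition demand (m : nat) (R : realType) (v : {set 'I_m} -> R)
    (p : 'I_m -> R) (M : {set 'I_m}) : {set {set 'I_m}} :=
  finset (fun B : {set 'I_m} =>
    (B \subset M) &&
    [forall C : {set 'I_m}, (C \subset M) ==> (utility v p C <= utility v p B)]).

Definition XOS_distribution (m : nat) (R : realType)
    (Di : probability (setfun m R) R) : Prop :=
  {ae Di, forall v, is_valuation v /\ is_XOS v}.

Definition generic (m : nat) (R : realType)
    (Di : probability (setfun m R) R) : Prop :=
  forall (p : 'I_m -> R) (M : {set 'I_m}), (forall j, 0 <= p j) ->
    {ae Di, forall v, #|demand v p M| = 1%N}.

(* D is the product measure D_1 x ... x D_n: rectangles generate the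
   sigma-algebra of profiles and are closed under intersection, so this
   determines D; taking all factors but one full, Di i is the i-th marginal. *)
Definition is_product_distribution (n m : nat) (R : realType)
    (Di : 'I_n -> probability (setfun m R) R)
    (D : probability (profile n m R) R) : Prop :=
  forall A : 'I_n -> set (setfun m R), (forall i, measurable (A i)) ->
    D [set v | forall i, A i (tnth v i)] = (\prod_(i < n) Di i (A i))%E.

Definition available (n m : nat) (X : 'I_n -> {set 'I_m}) (i : 'I_n) :
    {set 'I_m} :=
  finset.setC (\bigcup_(k < n | (k < i)%N) X k)%SET.

(* X v i is the set bought by buyer i on the profile v at prices p.  Ties may be
   broken arbitrarily; for a generic distribution X is almost surely unique. *)
Definition is_posted_price_mechanism (n m : nat) (R : realType)
    (p : 'I_m -> R) (X : profile n m R -> 'I_n -> {set 'I_m}) : Prop :=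
  forall v : profile n m R, (forall i, is_valuation (tnth v i)) ->
    forall i, X v i \in demand (tnth v i) p (available (X v) i).

Definition measurable_allocation (n m : nat) (R : realType)
    (X : profile n m R -> 'I_n -> {set 'I_m}) : Prop :=
  forall (i : 'I_n) (B : {set 'I_m}), measurable [set v | X v i = B].

Definition sale_probability (n m : nat) (R : realType)
    (D : probability (profile n m R) R)
    (X : profile n m R -> 'I_n -> {set 'I_m}) (j : 'I_m) : \bar R :=
  D [set v | exists i, j \in X v i].

Definition median_prices (n m : nat) (R : realType)
    (D : probability (profile n m R) R)
    (X : profile n m R -> 'I_n -> {set 'I_m})
    (alpha : R) (p : 'I_m -> R) : Prop :=
  (forall j, (sale_probability D X j <= (1 - alpha)%:E)%E) /\
  (forall j, 0 < p j -> (alpha%:E <= sale_probability D X j)%E).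

Definition welfare (n m : nat) (R : realType) (v : profile n m R)
    (A : 'I_n -> {set 'I_m}) : R :=
  \sum_(i < n) tnth v i (A i).

Definition pairwise_disjoint (n m : nat) (A : 'I_n -> {set 'I_m}) : bool :=
  [forall i, forall k, (i != k) ==> [disjoint A i & A k]].

(* The default value 0 of the maximum is harmless: for valuations it is the
   welfare of the empty allocation. *)
Definition optimal_welfare (n m : nat) (R : realType) (v : profile n m R) : R :=
  \big[Num.max/0]_(A : {ffun 'I_n -> {set 'I_m}} | pairwise_disjoint A)
    welfare v A.

(* Main.v *)
(** Welfare splits into revenue and buyer utility.  Revenue is at least
    [alpha * \sum_j p j], since every item with a positive price sells with
    probability at least [alpha].  For utility, write [u v p M] for the best
    utility on the available set [M].  The set [M] met by buyer [i] depends on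
    her predecessors only, so it is independent of her valuation, and it
    contains any given item with probability at least [alpha].  Replacing [M] by an
    independent copy, we can bound [u (v i) p M] for one fixed profile [v]: if
    the optimum of [v] gives her [A i], with supporting additive function [a],
    she may buy the available items of [A i] with [a j >= p j].  On average over
    [M] this is worth at least [alpha * (v i (A i) - \sum_(j in A i) p j)], and
    the prices subtracted here are paid for by the revenue. *)

Require Import Defs.
From mathcomp Require Import all_boot all_order all_algebra.
From mathcomp Require Import all_classical all_reals all_analysis.
From mathcomp Require Import measurable_realfun.
Import Order.TTheory GRing.Theory Num.Theory.
Import numFieldNormedType.Exports.
Local Open Scope classical_set_scope.
Local Open Scope ring_scope.

Set Implicit Arguments.
Unset Strict Implicit.
Unset Printing Implicit Defensive.

(** * Best utilities, demand and available items *)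

(* For valuations the default value 0 is the utility of the empty set; for
   arbitrary set functions it keeps the maximum nonnegative. *)
Definition best_utility {m : nat} {R : realType} (v : {set 'I_m} -> R)
    (p : 'I_m -> R) (M : {set 'I_m}) : R :=
  \big[Num.max/0]_(B : {set 'I_m} | B \subset M) utility v p B.

(** Padding with the empty set from [i] on makes the purchases made before buyer [i] an element of a
    finite type, so that one can sum over all possible pasts. *)
Definition history {n m : nat} (A : 'I_n -> {set 'I_m}) (i : 'I_n) :
    {ffun 'I_n -> {set 'I_m}} :=
  [ffun k : 'I_n => if (k < i)%N then A k else finset.set0].

Lemma best_utility_ge0 (m : nat) (R : realType) (v : {set 'I_m} -> R) p M :
  0 <= best_utility v p M.
Proof. exact: bigmax_ge_id. Qed.

Lemma le_best_utility (m : nat) (R : realType) (v : {set 'I_m} -> R) p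
    (B M : {set 'I_m}) :
  B \subset M -> utility v p B <= best_utility v p M.
Proof. by move=> BM; exact: le_bigmax_cond. Qed.

Lemma demandP (m : nat) (R : realType) (v : {set 'I_m} -> R) p
    (B M : {set 'I_m}) :
  reflect (B \subset M /\ forall C : {set 'I_m}, C \subset M ->
             utility v p C <= utility v p B)
          (B \in demand v p M).
Proof.
rewrite finset.inE; apply: (iffP andP) => -[BM h]; split=> //.
  by move=> C CM; move/forallP/(_ C)/implyP: h; exact.
by apply/forallP => C; apply/implyP; exact: h.
Qed.

Lemma utility_demand (m : nat) (R : realType) (v : {set 'I_m} -> R) p
    (B M : {set 'I_m}) :
  is_valuation v -> B \in demand v p M -> utility v p B = best_utility v p M.
Proof.
move=> [v0 _ _] /demandP[BM Bmax]; apply/le_anti.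
rewrite le_best_utility//=; apply: bigmax_le => //.
have := Bmax finset.set0 (finset.sub0set _).
by rewrite /utility v0 finset.big_set0 subrr.
Qed.

Lemma available_history (n m : nat) (A : 'I_n -> {set 'I_m}) (i : 'I_n) :
  available (history A i) i = available A i.
Proof. by congr finset.setC; apply: eq_bigr => k ki; rewrite ffunE ki. Qed.

Lemma available_ext (n m : nat) (A B : 'I_n -> {set 'I_m}) (i : 'I_n) :
  (forall k : 'I_n, (k < i)%N -> A k = B k) -> available A i = available B i.
Proof. by move=> AB; congr finset.setC; apply: eq_bigr => k ki; exact: AB. Qed.

Lemma available_disjoint (n m : nat) (A : 'I_n -> {set 'I_m}) :
  (forall i, A i \subset available A i) -> pairwise_disjoint A.
Proof.
move=> AM.
have disj (i k : 'I_n) : (k < i)%N -> ([disjoint A k & A i] : bool).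
  move=> ki; rewrite disjoint_sym finset.disjoints_subset.
  apply: fintype.subset_trans (AM i) _; rewrite finset.setCS.
  exact: (finset.bigcup_sup k).
apply/forallP => i; apply/forallP => k; apply/implyP => ik.
case: (ltngtP i k) => [/disj //|/disj|/val_inj ik0].
  by rewrite disjoint_sym.
by rewrite ik0 eqxx in ik.
Qed.

(** * The deterministic inequality for XOS profiles *)

Lemma sum_pairwise_disjoint (n m : nat) (V : nmodType)
    (A : 'I_n -> {set 'I_m}) (F : 'I_m -> V) :
  pairwise_disjoint A ->
  \sum_i \sum_(j in A i) F j = \sum_(j in (\bigcup_i A i)%SET) F j.
Proof.
move=> disjA; rewrite finset.partition_disjoint_bigcup// => i k ik.
by move/forallP/(_ i)/forallP/(_ k)/implyP: disjA; exact.
Qed.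

(* Buying those items of [A] that are available and worth their price for the
   additive function supporting [v A] bounds the best utility from below. *)
Lemma XOS_weighted_best_utility (m : nat) (R : realType) (K : finType)
    (w : K -> R) (M : K -> {set 'I_m}) (v : {set 'I_m} -> R) p alpha
    (A : {set 'I_m}) :
  is_XOS v -> 0 <= alpha -> (forall k, 0 <= w k) ->
  (forall j, alpha <= \sum_k w k * (j \in M k)%:R) ->
  alpha * utility v p A <= \sum_k w k * best_utility v p (M k).
Proof.
move=> [k0 [a [_ aP]]] alpha0 w0 wM.
have [l vA] := (aP A).2.
pose B := [set j in A | p j <= a l j]%SET.
have best_ge k : \sum_(j in B) (a l j - p j) * (j \in M k)%:R
                 <= best_utility v p (M k).
  have -> : \sum_(j in B) (a l j - p j) * (j \in M k)%:R =
            \sum_(j in B :&: M k) (a l j - p j).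
    rewrite [RHS](eq_bigl (fun j => (j \in B) && (j \in M k))); last first.
      by move=> j; rewrite finset.in_setI.
    rewrite big_mkcondr; apply: eq_bigr => j _.
    by case: (j \in M k); rewrite ?mulr1 ?mulr0.
  apply: le_trans (le_best_utility v p (finset.subsetIr B (M k))).
  by rewrite sumrB lerB// (aP _).1.
apply: (@le_trans _ _ (\sum_k w k *
    \sum_(j in B) (a l j - p j) * (j \in M k)%:R));
  last by apply: ler_sum => k _; rewrite ler_wpM2l.
(* Exchanging the sums isolates, for each item, the total weight with which it is available. *)
have -> : \sum_k w k * \sum_(j in B) (a l j - p j) * (j \in M k)%:R =
          \sum_(j in B) (a l j - p j) * \sum_k w k * (j \in M k)%:R.
  under eq_bigr do rewrite mulr_sumr.
  rewrite exchange_big; apply: eq_bigr => j _; rewrite mulr_sumr.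
  by apply: eq_bigr => k _; rewrite mulrCA.
(* On [B] the margins [a l j - p j] are nonnegative, so that weight may be lowered to [alpha]. *)
apply: (@le_trans _ _ (\sum_(j in B) (a l j - p j) * alpha)); last first.
  apply: ler_sum => j; rewrite finset.inE => /andP[_ pa].
  by rewrite ler_wpM2l ?subr_ge0.
rewrite -mulr_suml mulrC ler_wpM2r// /utility vA -sumrB.
(* Items of [A] outside [B] have negative margin; leaving them out only increases the sum. *)
rewrite (big_setID B)/= -[leRHS]addr0 lerD//.
  by rewrite (_ : _ :&: _ = B)//; apply/finset.setIidPr/fintype.subsetP => j;
    rewrite finset.inE => /andP[].
apply: sumr_le0 => j; rewrite !finset.inE => /andP[+ jA].
by rewrite jA/= -ltNge subr_le0 => /ltW.
Qed.

Lemma optimal_welfare_ge0 (n m : nat) (R : realType) (v : profile n m R) :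
  0 <= optimal_welfare v.
Proof. exact: bigmax_ge_id. Qed.

(** Here [w i k] stands for the probability that buyer [i] meets the set [M i k], and [s j] for the
    probability that item [j] is sold. Any allocation [A] splits into utilities, bounded buyer by
    buyer, and prices; as [A] is disjoint, each price occurs at most once and is covered by the
    revenue term. *)
Lemma XOS_optimal_welfare_le (n m : nat) (R : realType) (K : finType)
    (w : 'I_n -> K -> R) (M : 'I_n -> K -> {set 'I_m}) (v : profile n m R)
    (p s : 'I_m -> R) alpha :
  (forall i, is_XOS (tnth v i)) -> 0 <= alpha -> (forall j, 0 <= p j) ->
  (forall i k, 0 <= w i k) ->
  (forall i j, alpha <= \sum_k w i k * (j \in M i k)%:R) ->
  (forall j, 0 <= s j) -> (forall j, 0 < p j -> alpha <= s j) ->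
  alpha * optimal_welfare v <=
    \sum_i \sum_k w i k * best_utility (tnth v i) p (M i k)
    + \sum_j p j * s j.
Proof.
move=> xos alpha0 p0 w0 wM s0 ps.
have rhs0 : 0 <= \sum_i \sum_k w i k * best_utility (tnth v i) p (M i k)
    + \sum_j p j * s j.
  rewrite addr_ge0// sumr_ge0// => [i _|j _]; last by rewrite mulr_ge0.
  by rewrite sumr_ge0// => k _; rewrite mulr_ge0// best_utility_ge0.
(* The case [alpha = 0] is set apart because the bound is divided by [alpha] to reach the
   maximum. *)
have [->|alpha_neq0] := eqVneq alpha 0; first by rewrite mul0r.
have alpha_gt0 : 0 < alpha by rewrite lt0r alpha_neq0.
rewrite mulrC -ler_pdivlMr//; apply: bigmax_le => [|A disjA].
  by rewrite divr_ge0.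
rewrite ler_pdivlMr// mulrC.
have -> : welfare v A = \sum_i utility (tnth v i) p (A i)
                        + \sum_i \sum_(j in A i) p j.
  by rewrite -big_split; apply: eq_bigr => i _; rewrite /utility/= subrK.
rewrite mulrDr lerD//.
  by rewrite mulr_sumr; apply: ler_sum => i _; exact: XOS_weighted_best_utility.
rewrite sum_pairwise_disjoint// mulr_sumr big_mkcond; apply: ler_sum => j _.
case: ifP => _; last by rewrite mulr_ge0.
(* A free item contributes zero on both sides; only a positive price calls for [alpha <= s j]. *)
rewrite mulrC; have := p0 j; rewrite le_eqVlt => /predU1P[<-|pj].
  by rewrite !mul0r.
by rewrite ler_wpM2l// ps.
Qed.

(** * Integration under independence, and measurability *)

(** Independence says that the image under [phi] of [P] restricted to [H] is [P H] times the image
    of [P]; [f] is integrated against both. *)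
Lemma ge0_integral_independent (d d' : measure_display) (T : measurableType d)
    (T' : measurableType d') (R : realType) (P : probability T R)
    (phi : T -> T') (H : set T) (f : T' -> \bar R) :
  measurable_fun setT phi -> measurable H -> measurable_fun setT f ->
  (forall x, 0 <= f x)%E ->
  (forall E, measurable E -> P (H `&` phi @^-1` E) = P H * P (phi @^-1` E))%E ->
  (\int[P]_(x in H) f (phi x) = P H * \int[P]_x f (phi x))%E.
Proof.
move=> mphi mH mf f0 indep.
have mfphi D : measurable_fun D (f \o phi).
  by apply: measurable_funTS; exact: measurableT_comp.
have PH : (fine (P H))%:E = P H by rewrite fineK// fin_num_measure.
have PH0 : 0 <= fine (P H) by rewrite fine_ge0.
pose PrH : measure T R := mrestr P mH.
have -> : (\int[P]_(x in H) f (phi x) = \int[PrH]_(x in H) f (phi x))%E.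
  by apply: eq_measure_integral => A mA AH; rewrite /PrH/= /mrestr setIidl.
(* [PrH] is null outside [H], so the domain can be enlarged to the whole space before pushing
   forward. *)
have -> : (\int[PrH]_(x in H) f (phi x) = \int[PrH]_x f (phi x))%E.
  rewrite [RHS](@ge0_negligible_integral _ _ _ _ _ (~` H))//.
  - by rewrite setTD setCK.
  - exact: measurableC.
  - by rewrite /PrH/= /mrestr setICl measure0.
rewrite -[LHS](@ge0_integral_pushforward _ _ _ _ _ phi mphi PrH setT f)//.
rewrite (@eq_measure_integral _ _ _ _
  (mscale (NngNum PH0) (pushforward P phi))); last first.
  move=> A mA _.
  by rewrite /= /pushforward /PrH/= /mrestr setIC indep// /mscale/= PH.
rewrite ge0_integral_mscale//= PH; congr (_ * _)%E.
exact: ge0_integral_pushforward.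
Qed.

Lemma measurable_evaluation (m : nat) (R : realType) (B : {set 'I_m}) :
  measurable_fun setT (fun v : setfun m R => v B).
Proof.
move=> _ U mU; rewrite setTI; apply: sub_sigma_algebra.
by exists B, U.
Qed.

Lemma measurable_bigmax (d : measure_display) (T : measurableType d)
    (R : realType) (I : Type) (s : seq I) (Q : pred I) (f : I -> T -> R) D :
  (forall i, measurable_fun D (f i)) ->
  measurable_fun D (fun x => \big[Num.max/0]_(i <- s | Q i) f i x).
Proof.
move=> mf; elim: s => [|i s IH].
  by under eq_fun do rewrite big_nil; exact: measurable_cst.
under eq_fun do rewrite big_cons; case: (Q i) => //.
exact: measurable_maxr.
Qed.

Lemma measurable_best_utility (m : nat) (R : realType) (p : 'I_m -> R) M :
  measurable_fun setT (fun v : setfun m R => best_utility v p M).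
Proof.
apply: measurable_bigmax => B; apply: measurable_funB => //.
exact: measurable_evaluation.
Qed.

Lemma measurable_component (n m : nat) (R : realType) (i : 'I_n)
    (f : setfun m R -> R) :
  measurable_fun setT f ->
  measurable_fun setT (fun v : profile n m R => f (tnth v i)).
Proof.
move=> mf; have mi := @measurable_tnth _ (setfun m R) n i.
exact: (measurableT_comp mf mi).
Qed.

Lemma measurable_welfare (n m : nat) (R : realType) (A : 'I_n -> {set 'I_m}) :
  measurable_fun setT (fun v : profile n m R => welfare v A).
Proof.
apply: measurable_sum => i.
have mA := measurable_evaluation (R := R) (A i).
exact: (measurable_component i mA).
Qed.

Lemma measurable_optimal_welfare (n m : nat) (R : realType) :
  measurable_fun setT (fun v : profile n m R => optimal_welfare v).
Proof. by apply: measurable_bigmax => A; exact: measurable_welfare. Qed.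

Lemma measurable_demand (m : nat) (R : realType) (p : 'I_m -> R)
    (B M : {set 'I_m}) :
  measurable [set v : setfun m R | B \in demand v p M].
Proof.
have mu C : measurable_fun setT (fun v : setfun m R => utility v p C).
  by apply: measurable_funB => //; exact: measurable_evaluation.
have -> : [set v : setfun m R | B \in demand v p M] =
  \bigcap_(C in [set: {set 'I_m}]) [set v : setfun m R |
     (B \subset M) && ((C \subset M) ==> (utility v p C <= utility v p B))].
  apply/seteqP; split => v /=.
    by rewrite finset.inE => /andP[BM /forallP h] C _ /=; rewrite BM h.
  move=> h; rewrite finset.inE.
  have /andP[-> _] := h finset.set0 I.
  by apply/forallP => C; have /andP[] := h C I.
apply: fin_bigcap_measurable => // C _.
(* Only [B] and [C] both inside [M] give a genuine comparison of utilities; otherwise the event is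
   everything or empty. *)
case: (B \subset M); case: (C \subset M) => //=.
- rewrite -[X in measurable X]setTI.
  have := measurable_fun_ler (mu C) (mu B) measurableT (Y := [set true]).
  by apply.
- by rewrite [X in measurable X](_ : _ = setT)//; apply/seteqP; split.
- by rewrite [X in measurable X](_ : _ = set0)// -subset0.
- by rewrite [X in measurable X](_ : _ = set0)// -subset0.
Qed.

Lemma ge0_integral_EFin_sum (d : measure_display) (T : measurableType d)
    (R : realType) (mu : measure T R) (I : Type) (s : seq I) (f : I -> T -> R) :
  (forall i, measurable_fun setT (f i)) -> (forall i x, 0 <= f i x) ->
  (\int[mu]_x (\sum_(i <- s) f i x)%:E = \sum_(i <- s) \int[mu]_x (f i x)%:E)%E.
Proof.
move=> mf f0; under eq_integral do rewrite -sumEFin.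
rewrite ge0_integral_sum// => [i|i x _]; last by rewrite lee_fin.
exact/measurable_EFinP.
Qed.

Lemma integral_EFin_scaled_indic (d : measure_display) (T : measurableType d)
    (R : realType) (mu : measure T R) (c : R) (A : set T) :
  measurable A -> 0 <= c ->
  (\int[mu]_x (c * \1_A x)%:E = c%:E * mu A)%E.
Proof.
move=> mA c0; under eq_integral do rewrite EFinM.
rewrite ge0_integralZl_EFin//; first by rewrite integral_indic// setIT.
by apply/measurable_EFinP; exact: measurable_indic.
Qed.

Lemma ae_eq_measure (d : measure_display) (T : measurableType d)
    (R : realType) (mu : measure T R) (A B : set T) :
  measurable A -> measurable B -> (\forall x \ae mu, A x <-> B x) ->
  mu A = mu B.
Proof.
move=> mA mB AB; rewrite -[A]setIT -[B]setIT -!integral_indic//.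
apply: ge0_ae_eq_integral => //.
- by apply/measurable_EFinP; exact: measurable_indic.
- by apply/measurable_EFinP; exact: measurable_indic.
by apply: filterS AB => x ABx _; rewrite !indicE; congr (_%:R%:E);
  congr nat_of_bool; apply/idP/idP; rewrite !inE => /ABx.
Qed.

Lemma measurable_cylinder (n m : nat) (R : realType) (i : 'I_n)
    (E : set (setfun m R)) :
  measurable E -> measurable [set v : profile n m R | E (tnth v i)].
Proof.
move=> mE; have mi := @measurable_tnth _ (setfun m R) n i.
by have := mi measurableT E mE; rewrite setTI.
Qed.

Lemma measurable_rectangle (n m : nat) (R : realType)
    (A : 'I_n -> set (setfun m R)) :
  (forall k, measurable (A k)) ->
  measurable [set v : profile n m R | forall k, A k (tnth v k)].
Proof.
move=> mA.
rewrite [X in measurable X](_ : _ = \bigcap_(k in [set: 'I_n])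
    [set v : profile n m R | A k (tnth v k)]).
  by apply: fin_bigcap_measurable => // k _; exact: measurable_cylinder.
by apply/seteqP; split => [v Av k _|v Av k]; exact: Av.
Qed.

(** * Product distributions and almost sure properties *)

Section product_distribution.
Context (R : realType) (n m : nat) (Di : 'I_n -> probability (setfun m R) R)
  (D : probability (profile n m R) R) (hD : is_product_distribution Di D).

(** A rectangle that leaves coordinate [i] free stays a rectangle when [E] is imposed there, and the
    product formula then gains exactly the factor [Di i E]. *)
Lemma product_distribution_split (i : 'I_n) (A : 'I_n -> set (setfun m R))
    (E : set (setfun m R)) :
  (forall k, measurable (A k)) -> A i = setT -> measurable E ->
  (D [set v | (forall k, A k (tnth v k)) /\ E (tnth v i)] =
   D [set v | forall k, A k (tnth v k)] * Di i E)%E.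
Proof.
move=> mA Ai mE.
pose A' k := if k == i then E else A k.
have -> : [set v : profile n m R | (forall k, A k (tnth v k)) /\ E (tnth v i)] =
          [set v : profile n m R | forall k, A' k (tnth v k)].
  apply/seteqP; split => v /=.
    by move=> [Av Ev] k; rewrite /A'; case: eqP => [->|_].
  move=> Av; split=> [k|]; last by have := Av i; rewrite /A' eqxx.
  by have := Av k; rewrite /A'; case: eqP => // ->; rewrite Ai.
rewrite !hD//; last by move=> k; rewrite /A'; case: eqP.
rewrite [LHS](bigD1 i)//= [in RHS](bigD1 i)//= Ai probability_setT mul1e.
rewrite muleC; congr (_ * _)%E; last by rewrite /A' eqxx.
by apply: eq_bigr => k ki; rewrite /A' (negbTE ki).
Qed.

Lemma product_distribution_marginal (i : 'I_n) (E : set (setfun m R)) :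
  measurable E -> D [set v | E (tnth v i)] = Di i E.
Proof.
move=> mE.
have := @product_distribution_split i (fun=> setT) E (fun=> measurableT)
  erefl mE.
rewrite [X in (_ = D X * _)%E -> _](_ : _ = setT); last by apply/seteqP; split.
rewrite probability_setT mul1e => <-; congr (D _).
by apply/seteqP; split=> v //= -[].
Qed.

Lemma product_distribution_ae (i : 'I_n) (Q : setfun m R -> Prop) :
  {ae Di i, forall w, Q w} -> {ae D, forall v, Q (tnth v i)}.
Proof.
move=> [N [mN N0 NQ]]; exists [set v : profile n m R | N (tnth v i)]; split.
- exact: measurable_cylinder.
- by rewrite product_distribution_marginal.
- by move=> v /= nQ; apply: NQ.
Qed.

End product_distribution.

(** The prices are fixed and there are finitely many sets [M], so uniqueness of demand for all [M]
    at once still holds almost surely under genericity. *)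
Definition regular_profile (n m : nat) (R : realType) (p : 'I_m -> R)
    (v : profile n m R) : Prop :=
  forall i, [/\ is_valuation (tnth v i), is_XOS (tnth v i) &
    forall M, #|demand (tnth v i) p M| = 1%N].

Lemma regular_profile_ae (R : realType) (n m : nat)
    (Di : 'I_n -> probability (setfun m R) R)
    (D : probability (profile n m R) R) (p : 'I_m -> R) :
  is_product_distribution Di D -> (forall i, XOS_distribution (Di i)) ->
  (forall i, generic (Di i)) -> (forall j, 0 <= p j) ->
  {ae D, forall v, regular_profile p v}.
Proof.
move=> hD hXOS hgen p0; apply: filter_forall => i.
apply: (product_distribution_ae hD (i := i) (Q := fun w : setfun m R =>
  [/\ is_valuation w, is_XOS w & forall M, #|demand w p M| = 1%N])).
have hM : {ae Di i, forall w, forall M, #|demand w p M| = 1%N}.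
  apply: (@filter_forall _ _ (fun M w => #|demand w p M| = 1%N) _
    (ae_filter_ringOfSetsType (Di i))) => M.
  exact: hgen.
have := @filterS2 _ _ (ae_filter_ringOfSetsType (Di i)).
move=> /(_ _ _ _ _ (hXOS i) hM); apply => w [? ?] hMw; split=> //.
Qed.

(** * Purchase histories and the welfare of the mechanism *)

Section mechanism.
Context (R : realType) (n m : nat) (Di : 'I_n -> probability (setfun m R) R)
  (D : probability (profile n m R) R) (p : 'I_m -> R)
  (X : profile n m R -> 'I_n -> {set 'I_m}).
Hypotheses (hD : is_product_distribution Di D)
  (hXOS : forall i, XOS_distribution (Di i)) (hgen : forall i, generic (Di i))
  (p0 : forall j, 0 <= p j) (hX : is_posted_price_mechanism p X)
  (mX : measurable_allocation X).

(** For fixed [i] these events partition the profiles into finitely many pieces, on each of which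
    the set offered to buyer [i] is constant. *)
Let past (i : 'I_n) (B : {ffun 'I_n -> {set 'I_m}}) : set (profile n m R) :=
  [set v | history (X v) i = B].

Lemma measurable_past i B : measurable (past i B).
Proof.
rewrite (_ : past i B = \bigcap_(k in [set: 'I_n])
    [set v | (if (k < i)%N then X v k else finset.set0) = B k]).
  apply: fin_bigcap_measurable => // k _; case: (k < i)%N; first exact: mX.
  have [->|B0] := eqVneq (B k) finset.set0.
    by rewrite [X in measurable X](_ : _ = setT)//; apply/seteqP; split.
  rewrite [X in measurable X](_ : _ = set0)//.
  by apply/seteqP; split => // v /= B0'; rewrite -B0' eqxx in B0.
apply/seteqP; split => v /=.
  by move=> <- k _ /=; rewrite ffunE.
by move=> h; apply/ffunP => k; rewrite ffunE; exact: h.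
Qed.

Lemma measurable_sold j : measurable [set v | exists i, j \in X v i].
Proof.
rewrite (_ : [set _ | _] = \bigcup_(i in [set: 'I_n])
    \bigcup_(B in [set B : {set 'I_m} | j \in B]) [set v | X v i = B]).
  by apply: fin_bigcup_measurable => // i _; apply: fin_bigcup_measurable.
apply/seteqP; split => v /=.
  by move=> [i ji]; exists i => //; exists (X v i).
by move=> [i _ [B /= jB XB]]; exists i; rewrite XB.
Qed.

(* Where demands are unique, the purchases of the first [i] buyers equal [B]
   exactly when each of these buyers demands [B k] given the purchases [B] of
   her predecessors: up to a null set, the past of buyer [i] is a rectangle
   that does not constrain her valuation. *)
Lemma past_independent i B (E : set (setfun m R)) : measurable E ->
  (D (past i B `&` [set v | E (tnth v i)]) =
   D (past i B) * D [set v | E (tnth v i)])%E.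
Proof.
move=> mE; rewrite (product_distribution_marginal hD)//.
(* A history is empty from buyer [i] on; for any other [B] the event is empty and both sides
   vanish. *)
have [/forallP B0|/forallPn[k]] :=
  boolP [forall k : 'I_n, (i <= k)%N ==> (B k == finset.set0)]; last first.
  rewrite negb_imply => /andP[ik Bk].
  have -> : past i B = set0.
    apply/seteqP; split => // v /= hB; move: Bk.
    by rewrite -hB ffunE ltnNge ik eqxx.
  by rewrite set0I measure0 mul0e.
pose A (k : 'I_n) := if (k < i)%N then
  [set w : setfun m R | B k \in demand w p (available B k)] else setT.
have mA k : measurable (A k).
  by rewrite /A; case: ifP => // _; exact: measurable_demand.
have Ai : A i = setT by rewrite /A ltnn.
have pastE : \forall v \ae D, past i B v <-> forall k, A k (tnth v k).
  apply: filterS (regular_profile_ae hD hXOS hgen p0) => v rv.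
  have XD := hX (fun i => let: And3 h _ _ := rv i in h).
  split=> [hB k|Av].
    rewrite /A; case: ifPn => // ki /=.
    have XB (l : 'I_n) : (l < i)%N -> X v l = B l.
      by move=> li; rewrite -hB ffunE li.
    rewrite -XB// (available_ext (A := B) (B := X v))//.
    by move=> l lk; rewrite XB// (ltn_trans lk).
  (* Induction along the arrival order: once earlier purchases agree with [B], buyer [k] faces the
     same available set, and [X v k] and [B k] both lie in her demand, a singleton. *)
  have XB : forall N (k : 'I_n), (k < N)%N -> (k < i)%N -> X v k = B k.
    elim=> // N IH k kN ki; have [_ _ dem1] := rv k.
    have := Av k; rewrite /A ki /=.
    rewrite (available_ext (A := B) (B := X v)); last first.
      move=> l lk; rewrite IH//; first exact: leq_trans lk _.
      exact: ltn_trans ki.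
    have /eqP/cards1P[C demE] := dem1 (available (X v) k).
    rewrite demE finset.in_set1 => /eqP ->; move: (XD k).
    by rewrite demE !finset.in_set1 => /eqP.
  apply/ffunP => k; rewrite ffunE; case: ifPn => [ki|]; first exact: (XB k.+1).
  by rewrite -leqNgt => ik; move/implyP/(_ ik)/eqP: (B0 k).
have mrect : measurable [set v : profile n m R | forall k, A k (tnth v k)].
  exact: measurable_rectangle.
rewrite (ae_eq_measure (measurable_past i B) mrect pastE).
rewrite -(product_distribution_split hD)//; apply: ae_eq_measure.
- by apply: measurableI; [exact: measurable_past|exact: measurable_cylinder].
- by apply: measurableI => //; exact: measurable_cylinder.
by apply: filterS pastE => v [AB BA]; split=> -[? ?]; split=> //; auto.
Qed.

(** In the inner sum only [B = history (X v) i] survives, and there a demanded set attains the best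
    utility. Purchases are disjoint, so the revenue counts each sold item once. *)
Lemma welfare_regular v : regular_profile p v ->
  welfare v (X v) =
    \sum_i \sum_(B : {ffun 'I_n -> {set 'I_m}})
      \1_(past i B) v * best_utility (tnth v i) p (available B i)
    + \sum_j p j * \1_[set v | exists i, j \in X v i] v.
Proof.
move=> rv.
have XD := hX (fun i => let: And3 h _ _ := rv i in h).
have disjX : pairwise_disjoint (X v).
  by apply: available_disjoint => i; have /demandP[] := XD i.
have -> : welfare v (X v) = \sum_i utility (tnth v i) p (X v i)
                            + \sum_i \sum_(j in X v i) p j.
  by rewrite -big_split; apply: eq_bigr => i _; rewrite /utility/= subrK.
congr (_ + _).
  apply: eq_bigr => i _; rewrite (bigD1 (history (X v) i))//= big1 => [|B BX].
    rewrite indicE mem_set//= mul1r addr0 available_history.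
    by apply: utility_demand; [have [] := rv i|exact: XD].
  by rewrite indicE memNset ?mul0r// => /esym/eqP; rewrite (negbTE BX).
rewrite sum_pairwise_disjoint// big_mkcond; apply: eq_bigr => j _.
rewrite indicE; case: finset.bigcupP => [[i _ ji]|nj].
  by rewrite mem_set ?mulr1//; exists i.
by rewrite memNset ?mulr0// => -[i ji]; apply: nj; exists i.
Qed.

Lemma measurable_posted_price_welfare :
  measurable_fun setT (fun v => welfare v (X v)).
Proof.
rewrite (_ : (fun v => _) = fun v => \sum_i \sum_(B : {set 'I_m})
    \1_[set v | X v i = B] v * tnth v i B).
  apply: measurable_sum => i; apply: measurable_sum => B.
  apply: measurable_funM; first exact: measurable_indic.
  have mB := measurable_evaluation (R := R) B.
  exact: (measurable_component i mB).
apply/funext => v; apply: eq_bigr => i _.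
rewrite (bigD1 (X v i))//= big1 => [|B BX].
  by rewrite indicE mem_set//= mul1r addr0.
by rewrite indicE memNset ?mul0r// => /esym/eqP; rewrite (negbTE BX).
Qed.

(** * Expectations and the welfare bound *)

(** This is the passage to an independent copy of the past: under the integral its indicator may be
    replaced by its probability. *)
Lemma integral_past i B (f : setfun m R -> R) :
  measurable_fun setT f -> (forall w, 0 <= f w) ->
  (\int[D]_v (\1_(past i B) v * f (tnth v i))%:E =
   \int[D]_v (fine (D (past i B)) * f (tnth v i))%:E)%E.
Proof.
move=> mf f0.
transitivity (\int[D]_(v in past i B) (f (tnth v i))%:E)%E.
  rewrite [RHS]integral_mkcond; apply: eq_integral => v _.
  by rewrite indicE patchE; case: ifP => _; rewrite ?mul1r ?mul0r.
have mi := @measurable_tnth _ (setfun m R) n i.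
rewrite (ge0_integral_independent (P := D) mi (measurable_past i B)
  (f := EFin \o f))//.
- under [RHS]eq_integral do rewrite EFinM.
  rewrite ge0_integralZl_EFin//.
  + by rewrite fineK// fin_num_measure//; exact: measurable_past.
  + by move=> v _; rewrite lee_fin.
  + by apply/measurable_EFinP; exact: measurable_component.
  + by rewrite fine_ge0.
- exact/measurable_EFinP.
- by move=> E mE; exact: past_independent.
Qed.

(** An item that nobody buys is available to every buyer, and it stays unsold with probability at
    least [1 - (1 - alpha) = alpha]. The sum is the probability that [j] is available to buyer [i],
    split by pasts. *)
Lemma available_probability i j (alpha : R) :
  (sale_probability D X j <= (1 - alpha)%:E)%E ->
  alpha <= \sum_B fine (D (past i B)) * (j \in available B i)%:R.
Proof.
rewrite /sale_probability; set sold := (X in D X) => sj.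
have mS : measurable sold := measurable_sold j.
pose g (B : {ffun 'I_n -> {set 'I_m}}) v : R :=
  (j \in available B i)%:R * \1_(past i B) v.
have mg B : measurable_fun setT (g B).
  apply: measurable_funM => //; apply: measurable_indic.
  exact: measurable_past.
have unsold v : \1_(~` sold) v <= \sum_B g B v.
  have g0 B : 0 <= g B v by rewrite mulr_ge0.
  rewrite (bigD1 (history (X v) i))//= -[leLHS]addr0 lerD ?sumr_ge0//.
  rewrite /g !indicE (mem_set (erefl : past i (history (X v) i) v)) mulr1.
  rewrite available_history.
  case: (boolP (v \in ~` sold)) => // /set_mem vS.
  suff -> : j \in available (X v) i by [].
  rewrite finset.in_setC.
  by apply/finset.bigcupP => -[k _ jk]; apply: vS; exists k.
rewrite -lee_fin; apply: (@le_trans _ _ (D (~` sold))).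
  rewrite probability_setC// -[D sold]fineK ?fin_num_measure//.
  move: sj; rewrite -[D sold]fineK ?fin_num_measure// -EFinB !lee_fin.
  by rewrite lerBrDl -lerBrDr.
have -> : (D (~` sold) = \int[D]_v (\1_(~` sold) v)%:E)%E.
  by rewrite integral_indic ?setIT//; exact: measurableC.
apply: (@le_trans _ _ (\int[D]_v (\sum_B g B v)%:E)%E).
  apply: ge0_le_integral => //.
  - by apply/measurable_EFinP; apply: measurable_indic; exact: measurableC.
  - by apply/measurable_EFinP; exact: measurable_sum.
  - by move=> v _; rewrite lee_fin.
rewrite ge0_integral_EFin_sum//; last by move=> B v; rewrite mulr_ge0.
rewrite -sumEFin; apply: lee_sum => B _.
rewrite integral_EFin_scaled_indic//; last exact: measurable_past.
by rewrite EFinM muleC fineK// fin_num_measure//; exact: measurable_past.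
Qed.

Lemma posted_price_welfare_bound (alpha : R) :
  0 <= alpha -> median_prices D X alpha p ->
  (alpha%:E * 'E_D[fun v => optimal_welfare v]
    <= 'E_D[fun v => welfare v (X v)])%E.
Proof.
move=> alpha0 [sold_le sold_ge].
have aeR := regular_profile_ae hD hXOS hgen p0.
pose sold j : set (profile n m R) := [set v | exists i, j \in X v i].
pose best i (B : {ffun 'I_n -> {set 'I_m}}) (v : profile n m R) :=
  best_utility (tnth v i) p (available B i).
(* [U] uses the realized pasts of [v], while [Uind] averages over pasts drawn independently of [v];
   they agree in expectation only. *)
pose U v := \sum_i \sum_(B : {ffun 'I_n -> {set 'I_m}})
  \1_(past i B) v * best i B v.
pose Uind v := \sum_i \sum_(B : {ffun 'I_n -> {set 'I_m}})
  fine (D (past i B)) * best i B v.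
pose rev v : R := \sum_j p j * \1_(sold j) v.
pose s j := fine (D (sold j)).
have s0 j : 0 <= s j by exact: fine_ge0.
have sE j : (s j)%:E = D (sold j).
  by rewrite fineK// fin_num_measure//; exact: measurable_sold.
have w0 i B : 0 <= fine (D (past i B)) by exact: fine_ge0.
have best0 i B v : 0 <= best i B v by exact: best_utility_ge0.
have mbest i B : measurable_fun setT (best i B).
  have mb := @measurable_best_utility m R p (available B i).
  exact: (measurable_component i mb).
have m1best i B : measurable_fun setT (fun v => \1_(past i B) v * best i B v).
  apply: measurable_funM => //; apply: measurable_indic.
  exact: measurable_past.
have mwbest i B :
    measurable_fun setT (fun v => fine (D (past i B)) * best i B v).
  exact: measurable_funM.
have mrev_j j : measurable_fun setT (fun v => p j * \1_(sold j) v).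
  apply: measurable_funM => //; apply: measurable_indic.
  exact: measurable_sold.
have mU : measurable_fun setT U by do 2 (apply: measurable_sum => ?).
have mUind : measurable_fun setT Uind by do 2 (apply: measurable_sum => ?).
have mrev : measurable_fun setT rev by apply: measurable_sum.
have U1_ge0 i B v : 0 <= \1_(past i B) v * best i B v by rewrite mulr_ge0.
have Uw_ge0 i B v : 0 <= fine (D (past i B)) * best i B v by rewrite mulr_ge0.
have rev_ge0 j v : 0 <= p j * \1_(sold j) v by rewrite mulr_ge0.
have U_ge0 v : 0 <= U v by do 2 (apply: sumr_ge0 => ? _).
have Uind_ge0 v : 0 <= Uind v by do 2 (apply: sumr_ge0 => ? _).
have ps_ge0 : 0 <= \sum_j p j * s j by apply: sumr_ge0 => j _; rewrite mulr_ge0.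
have UE : (\int[D]_v (U v)%:E = \int[D]_v (Uind v)%:E)%E.
  rewrite !ge0_integral_EFin_sum//; try by [move=> i v; exact: sumr_ge0
    | move=> i; exact: measurable_sum].
  apply: eq_bigr => i _; rewrite !ge0_integral_EFin_sum//.
  apply: eq_bigr => B _.
  apply: (integral_past i B (f := fun w => best_utility w p (available B i))).
    exact: measurable_best_utility.
  by move=> w; exact: best_utility_ge0.
have revE : (\int[D]_v (rev v)%:E = (\sum_j p j * s j)%:E)%E.
  rewrite ge0_integral_EFin_sum// -sumEFin; apply: eq_bigr => j _.
  by rewrite integral_EFin_scaled_indic ?EFinM ?sE//; exact: measurable_sold.
(* The expected revenue enters the integrand as a constant, which brings the claim into a form that
   can be compared profile by profile. *)
have -> : ('E_D[fun v => welfare v (X v)] =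
    \int[D]_v (Uind v + \sum_j p j * s j)%:E)%E.
  rewrite unlock; transitivity (\int[D]_v (U v + rev v)%:E)%E.
    apply: ae_eq_integral => //.
    - by apply/measurable_EFinP; exact: measurable_posted_price_welfare.
    - by apply/measurable_EFinP; exact: measurable_funD.
    - by apply: filterS aeR => v rv _; rewrite (welfare_regular rv).
  under eq_integral do rewrite EFinD.
  under [RHS]eq_integral do rewrite EFinD.
  rewrite !ge0_integralD//; try by [exact/measurable_EFinP
    | move=> v _; rewrite lee_fin | move=> v _; rewrite lee_fin sumr_ge0].
  rewrite UE revE integral_cst// [X in (_ * X)%E](_ : _ = 1%E) ?mule1//.
  exact: probability_setT.
rewrite unlock -ge0_integralZl_EFin//; last first.
- by apply/measurable_EFinP; exact: measurable_optimal_welfare.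
- by move=> v _; rewrite lee_fin optimal_welfare_ge0.
apply: ae_ge0_le_integral => //.
- by move=> v _; rewrite mule_ge0 ?lee_fin// optimal_welfare_ge0.
- apply/measurable_EFinP; apply: measurable_funM => //.
  exact: measurable_optimal_welfare.
- by move=> v _; rewrite lee_fin addr_ge0.
- by apply/measurable_EFinP; exact: measurable_funD.
(* On a regular profile this is the deterministic inequality, with the probabilities of the pasts as
   weights and the sale probabilities as [s]. *)
apply: filterS aeR => v rv _; rewrite -EFinM lee_fin.
apply: XOS_optimal_welfare_le => //.
- by move=> i; have [] := rv i.
- by move=> i j; exact: available_probability.
- by move=> j pj; rewrite -lee_fin sE; exact: sold_ge.
Qed.

End mechanism.

Theorem theorem4p3 (R : realType) (n m : nat)
    (Di : 'I_n -> probability (setfun m R) R)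
    (D : probability (profile n m R) R)
    (hD : is_product_distribution Di D)
    (hXOS : forall i, XOS_distribution (Di i))
    (hgen : forall i, generic (Di i))
    (alpha : R) (halpha : 0 <= alpha <= 2^-1)
    (p : 'I_m -> R) (hp : forall j, 0 <= p j)
    (X : profile n m R -> 'I_n -> {set 'I_m})
    (hX : is_posted_price_mechanism p X)
    (mX : measurable_allocation X)
    (hmed : median_prices D X alpha p) :
  (alpha%:E * 'E_D[fun v => optimal_welfare v]
    <= 'E_D[fun v => welfare v (X v)])%E.
Proof.
case/andP: halpha => alpha0 _.
exact: (posted_price_welfare_bound hD hXOS hgen hp hX mX alpha0 hmed).
Qed.
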